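(* Let $k$ be a (commutative) ring of characteristic $p>0$, $p$ prime. Let $m_0$ be the ideal $(x_1,\dots,x_n)$ in $k[x_1,\dots,x_n]$ and let $I\subset m_0^2$ be an ideal. Let $A_0=k[x_1,\dots,x_n]/((x_1^{i_1},\dots,x_n^{i_n})+I)$, where the $i_j$ are positive integers with $i_j\le p$ for all $j$. Let $T_0\subset I$ be any subset generating $I$. Then the following conditions are equivalent: 1. $m_0A_0$ admits a divided power structure; 2. $w_p(f_0)\in(x_1^{i_1},\dots,x_n^{i_n})+I$ for all $f_0\in I$; 3. $w_p(f_0)\in(x_1^{i_1},\dots,x_n^{i_n})+I$ for all $f_0\in T_0$.
   Context: For a polynomial $f=\sum_{i=1}^m a_i x^{J_i}$ written as a sum of distinct monomials ($J_i$ multi-indices), over a ring in which $(p-1)!$ is invertible, define $$w_p(f):=\sum_{\substack{l_1+\dots+l_m=p\\ 0\le l_j<p}}\frac{1}{l_1!\cdots l_m!}(a_1x^{J_1})^{l_1}\cdots(a_mx^{J_m})^{l_m}.$$ A divided power structure on an ideal $I$ of a commutative ring $A$ is a sequence of maps $\gamma_n: I\to A$, $n\ge 0$, such that for all $x,y\in I$, $a\in A$: $\gamma_0(x)=1$, $\gamma_1(x)=x$, $\gamma_n(x)\in I$ for $n\ge1$; $\gamma_n(x+y)=\sum_{i+j=n}\gamma_i(x)\gamma_j(y)$; $\gamma_n(ax)=a^n\gamma_n(x)$; $\gamma_n(x)\gamma_m(x)=\binom{n+m}{n}\gamma_{n+m}(x)$; $\gamma_n(\gamma_m(x))=\frac{(nm)!}{n!(m!)^n}\gamma_{nm}(x)$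 for $m\ge 1$. *)

(* Defs.v *)
From HB Require Import structures.
From mathcomp Require Import all_boot all_order all_algebra.
From mathcomp Require Import ring_quotient generic_quotient.
From mathcomp Require Import boolp classical_sets.
From mathcomp Require Export mpoly.

Set Implicit Arguments.
Unset Strict Implicit.
Unset Printing Implicit Defensive.

Import GRing.Theory.
Local Open Scope classical_set_scope.
Local Open Scope ring_scope.
Local Open Scope quotient_scope.

Section Ideals.
Variable R : comPzRingType.

Definition is_ideal (I : set R) : Prop :=
  [/\ I 0, forall x y, I x -> I y -> I (x + y) & forall a x, I x -> I (a * x)].

Record ideal := Ideal { ideal_set :> set R; idealP : is_ideal ideal_set }.

Definition ideal_mem (I : ideal) (x : R) : Prop := ideal_set I x.

Lemma smallest_is_ideal (T : set R) : is_ideal (smallest is_ideal T).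
Proof.
split=> [J [[] //]|x y Ix Iy J [JJ TJ]|a x Ix J [JJ TJ]].
- by case: (JJ) => _ JD _; apply: JD; [apply: Ix|apply: Iy].
- by case: (JJ) => _ _ JM; apply: JM; apply: Ix.
Qed.

Definition ideal_gen (T : set R) : ideal := Ideal (smallest_is_ideal T).

Lemma add_is_ideal (I J : ideal) : is_ideal [set x + y | x in I & y in J].
Proof.
case: I J => [I [I0 ID IM]] [J [J0 JD JM]] /=; split.
- by exists 0 => //; exists 0 => //; rewrite addr0.
- move=> _ _ [x Ix [y Jy <-]] [z Iz [t Jt <-]].
  by exists (x + z); [exact: ID|exists (y + t); [exact: JD|rewrite addrACA]].
- move=> a _ [x Ix [y Jy <-]].
  by exists (a * x); [exact: IM|exists (a * y); [exact: JM|rewrite mulrDr]].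
Qed.

Definition ideal_add (I J : ideal) : ideal := Ideal (add_is_ideal I J).

Definition ideal_mul (I J : ideal) : ideal :=
  ideal_gen [set x * y | x in I & y in J].

End Ideals.

Coercion ideal_mem : ideal >-> Funclass.

(* The quotient of a commutative ring by an arbitrary ideal. The quotient      *)
(* group is [Quotient.quot] of ring_quotient; the multiplication is added here *)
(* because ring_quotient only provides it for proper ideals.                   *)
Section QuotientRing.
Variables (R : comPzRingType) (J : ideal R).

Definition ideal_pred : {pred R} := fun x => `[< J x >].

Lemma ideal_predP x : reflect (J x) (x \in ideal_pred).
Proof. exact: asboolP. Qed.

Lemma ideal_pred_zmod : zmod_closed ideal_pred.
Proof.
have [J0 JD JM] := idealP J; split; first exact/ideal_predP.
move=> x y /ideal_predP Jx /ideal_predP Jy; apply/ideal_predP/JD => //.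
by rewrite -mulN1r; apply: JM.
Qed.

HB.instance Definition _ := GRing.isZmodClosed.Build R ideal_pred ideal_pred_zmod.

Definition quot_ring := Quotient.quot ideal_pred.
HB.instance Definition _ := GRing.Zmodule.on quot_ring.
HB.instance Definition _ := EqQuotient.on quot_ring.

Definition quot_proj (x : R) : quot_ring := \pi_quot_ring x.

Definition quot_mul (x y : quot_ring) : quot_ring :=
  quot_proj (repr x * repr y).

Lemma quot_proj_eq x y : quot_proj x = quot_proj y <-> J (x - y).
Proof.
split=> [/eqP|]; last first.
  by move=> h; apply/eqP; rewrite /quot_proj -Quotient.idealrBE; apply/ideal_predP.
by rewrite /quot_proj -Quotient.idealrBE => /ideal_predP.
Qed.

Lemma quot_projK (x : quot_ring) : quot_proj (repr x) = x.
Proof. exact: reprK. Qed.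

Lemma quot_projB : {morph quot_proj : x y / x - y}.
Proof. by move=> x y; rewrite /quot_proj !piE. Qed.

Lemma quot_projM : {morph quot_proj : x y / x * y >-> quot_mul x y}.
Proof.
have [J0 JD JM] := idealP J.
move=> x y; apply/quot_proj_eq.
set x' := repr _; set y' := repr _.
have Jx : J (x - x') by apply/quot_proj_eq; rewrite quot_projK.
have Jy : J (y - y') by apply/quot_proj_eq; rewrite quot_projK.
have -> : x * y - x' * y' = y * (x - x') + x' * (y - y').
  by rewrite !mulrBr addrA [y * x]mulrC [y * x']mulrC subrK.
by apply: JD; apply: JM.
Qed.

Lemma quot_projD : {morph quot_proj : x y / x + y}.
Proof. by move=> x y; rewrite /quot_proj !piE. Qed.

Lemma quot_mulA : associative quot_mul.
Proof.
move=> x y z; rewrite -(quot_projK x) -(quot_projK y) -(quot_projK z).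
by rewrite -!quot_projM mulrA.
Qed.

Lemma quot_mulC : commutative quot_mul.
Proof.
by move=> x y; rewrite -(quot_projK x) -(quot_projK y) -!quot_projM mulrC.
Qed.

Lemma quot_mul1 : left_id (quot_proj 1) quot_mul.
Proof. by move=> x; rewrite -(quot_projK x) -quot_projM mul1r. Qed.

Lemma quot_mulDl : left_distributive quot_mul +%R.
Proof.
move=> x y z; rewrite -(quot_projK x) -(quot_projK y) -(quot_projK z).
by rewrite -quot_projD -!quot_projM mulrDl quot_projD.
Qed.

HB.instance Definition _ := GRing.Zmodule_isComPzRing.Build quot_ring
  quot_mulA quot_mulC quot_mul1 quot_mulDl.

HB.instance Definition _ :=
  GRing.isZmodMorphism.Build R quot_ring quot_proj quot_projB.
HB.instance Definition _ :=
  GRing.isMonoidMorphism.Build R quot_ring quot_proj (erefl, quot_projM).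

End QuotientRing.

Definition ideal_ext (R S : comPzRingType) (f : R -> S) (I : ideal R) : ideal S :=
  ideal_gen (f @` I).

(* The maps gamma_n are total functions, but only their values on I are       *)
(* constrained or used. The quotient (n m)! / (n! (m!)^n) is exact.           *)
Record is_divided_power (A : comPzRingType) (I : ideal A)
    (gamma : nat -> A -> A) : Prop := IsDividedPower {
  dp0 : forall x, I x -> gamma 0%N x = 1;
  dp1 : forall x, I x -> gamma 1%N x = x;
  dp_ideal : forall n x, (1 <= n)%N -> I x -> I (gamma n x);
  dpD : forall n x y, I x -> I y ->
    gamma n (x + y) = \sum_(i < n.+1) gamma i x * gamma (n - i)%N y;
  dpMl : forall n a x, I x -> gamma n (a * x) = a ^+ n * gamma n x;
  dpM : forall n m x, I x ->
    gamma n x * gamma m x = 'C(n + m, n)%:R * gamma (n + m)%N x;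
  dp_comp : forall n m x, (1 <= m)%N -> I x ->
    gamma n (gamma m x) =
      ((n * m)`! %/ (n`! * m`! ^ n))%:R * gamma (n * m)%N x
}.

Definition admits_divided_powers (A : comPzRingType) (I : ideal A) : Prop :=
  exists gamma : nat -> A -> A, is_divided_power I gamma.

Section Polynomials.
Variables (n : nat) (k : comUnitRingType).

Definition max_ideal0 : ideal {mpoly k[n]} :=
  ideal_gen [set 'X_j | j in [set: 'I_n]].

Definition power_ideal (i : 'I_n -> nat) : ideal {mpoly k[n]} :=
  ideal_gen [set 'X_j ^+ i j | j in [set: 'I_n]].

(* [msupp f] lists, without repetition, the monomials with nonzero coefficient *)
(* in f; the exponents l_j range over 'I_p, i.e. 0 <= l_j < p.                 *)
Definition w_p (p : nat) (f : {mpoly k[n]}) : {mpoly k[n]} :=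
  let J (j : 'I_(size (msupp f))) : 'X_{1..n} := tnth (in_tuple (msupp f)) j in
  \sum_(l : {ffun 'I_(size (msupp f)) -> 'I_p} | (\sum_j l j == p)%N)
    (\prod_j (l j)`!%:R)^-1 *: \prod_j (f@_(J j) *: 'X_[J j]) ^+ l j.

End Polynomials.

(* Main.v *)
Require Import Defs.
From HB Require Import structures.
From mathcomp Require Import all_boot all_order all_algebra.
From mathcomp Require Import boolp classical_sets.
From mathcomp Require Import zify ring.

(** Write P = k[x_1, ..., x_n], K = (x_1^p, ..., x_n^p) and let J be the ideal
    (x_1^(i_1), ..., x_n^(i_n)) + I, which contains K because i_j <= p.

    The ideal of the variables in P/K has divided powers for which
    gamma_l(x_j) is x_j^l / l! for l < p and 0 for l >= p. They are given by a
    generating function: a monomial term t = c x^m, m <> 0, gets the truncated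
    exponential sum_(l < p) t^l / l! T^l, and a polynomial gets the product of
    those of its nonconstant terms [gen_fun]. As (x^m)^p lies in K, this is additive and
    homogeneous modulo K [gen_funD, gen_funMl]. The coefficient of T^p of the
    product is w_p(f) when f has no constant term [w_pE], so that gamma_p(f) is
    the class of w_p(f).

    An additive and homogeneous family satisfies the remaining axioms as soon as
    it satisfies them on generators [divided_power_gen]. The delicate axiom is
    gamma_n (gamma_m (x + y)): expanded by the other axioms, it becomes a
    combination of products gamma_a(x) gamma_b(y) with universal integer
    coefficients, which are identified by a computation with rational
    polynomials [composesD].

    If P/J has divided powers and f0 is in I, then gamma_p vanishes on every
    term of f0, since such a term is a multiple of some x_j y with y in the
    maximal ideal and x_j^p = 0. By additivity gamma_p(f0) is the class of
    w_p(f0); but f0 = 0 in P/J, so w_p(f0) is in J [divided_power_w_p].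

    Conversely, for the divided powers of P/K to descend to P/J the image of J
    must be stable under gamma_n for n > 0. In characteristic p this only has to
    be tested for gamma_p on generators [divided_power_subideal], because
    gamma_(pq) is gamma_q o gamma_p up to an invertible integer, and
    n gamma_n(s) = s gamma_(n-1)(s). On a generator f0 of I the test says that
    w_p(f0) is in J; on x_j^(i_j) it holds because gamma_p(x_j) = 0. *)

Set Implicit Arguments.
Unset Strict Implicit.
Unset Printing Implicit Defensive.

Import GRing.Theory.
Local Open Scope classical_set_scope.
Local Open Scope ring_scope.

(** * Ideals *)

Section IdealLemmas.
Variables (R : comPzRingType) (I : ideal R).

Lemma ideal0 : I 0. Proof. by case: (idealP I). Qed.

Lemma idealD x y : I x -> I y -> I (x + y).
Proof. by case: (idealP I) => _ ID _; apply: ID. Qed.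

Lemma ideal_mull a x : I x -> I (a * x).
Proof. by case: (idealP I) => _ _; apply. Qed.

Lemma ideal_mulr a x : I x -> I (x * a).
Proof. by rewrite mulrC; apply: ideal_mull. Qed.

Lemma idealN x : I x -> I (- x).
Proof. by rewrite -mulN1r; apply: ideal_mull. Qed.

Lemma ideal_sum (T : Type) (r : seq T) (P : pred T) (F : T -> R) :
  (forall t, P t -> I (F t)) -> I (\sum_(t <- r | P t) F t).
Proof. by move=> IF; apply: (big_ind I ideal0 idealD). Qed.

End IdealLemmas.

Section GeneratedIdeals.
Variables (R : comPzRingType) (S : set R).

Lemma mem_ideal_gen s : S s -> ideal_gen S s.
Proof. exact: sub_gen_smallest. Qed.

Lemma ideal_gen_sub (I : ideal R) : S `<=` I -> ideal_gen S `<=` I.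
Proof. by move=> SI; apply: smallest_sub => //; apply: idealP. Qed.

(** The induction hypotheses remember membership in the ideal, because
    the divided power axioms only speak about elements of the ideal. *)
Lemma ideal_gen_ind (P : R -> Prop) :
  P 0 ->
  (forall x y, ideal_gen S x -> ideal_gen S y -> P x -> P y -> P (x + y)) ->
  (forall a x, ideal_gen S x -> P x -> P (a * x)) ->
  (forall s, S s -> P s) ->
  forall x, ideal_gen S x -> P x.
Proof.
move=> P0 PD PM PS x Sx.
suff [] : (ideal_gen S `&` P) x by [].
apply: Sx; split; last by move=> s Ss; split; [apply: mem_ideal_gen|apply: PS].
split; first by split=> //; apply: (ideal0 (ideal_gen S)).
- move=> y z [Sy Py] [Sz Pz]; split; last exact: PD.
  exact: (idealD (I := ideal_gen S)).
- move=> a y [Sy Py]; split; last exact: PM.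
  exact: (ideal_mull (I := ideal_gen S)).
Qed.

End GeneratedIdeals.

Lemma ideal_ext_surj (R S : comPzRingType) (f : {rmorphism R -> S})
    (I : ideal R) :
  (forall y, exists x, f x = y) ->
  forall y, ideal_ext f I y <-> exists2 x, I x & f x = y.
Proof.
move=> f_surj y; split; last by case=> x Ix <-; apply: mem_ideal_gen; exists x.
move: y; apply: ideal_gen_ind.
- by exists 0; [apply: ideal0|rewrite rmorph0].
- move=> _ _ _ _ [x Ix <-] [x' Ix' <-].
  by exists (x + x'); [apply: idealD|rewrite rmorphD].
- move=> a _ _ [x Ix <-]; have [b <-] := f_surj a.
  by exists (b * x); [apply: ideal_mull|rewrite rmorphM].
- by move=> _ [x Ix <-]; exists x.
Qed.

Lemma ideal_ext_gen (R S : comPzRingType) (h : {rmorphism R -> S})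
    (T : set R) x :
  ideal_gen T x -> ideal_gen (h @` T) (h x).
Proof.
move: x; apply: ideal_gen_ind => [|x y _ _ Tx Ty|a x _ Tx|x Tx].
- by rewrite rmorph0; apply: ideal0.
- by rewrite rmorphD; apply: idealD.
- by rewrite rmorphM; apply: ideal_mull.
- by apply: mem_ideal_gen; exists x.
Qed.

Lemma quot_proj_surj (R : comPzRingType) (J : ideal R) (y : quot_ring J) :
  exists x, quot_proj J x = y.
Proof. by exists (repr y); apply: quot_projK. Qed.

Lemma quot_proj_eq0 (R : comPzRingType) (J : ideal R) x :
  quot_proj J x = 0 <-> J x.
Proof. by rewrite -(rmorph0 (quot_proj J)) quot_proj_eq subr0. Qed.

(** * The integers occurring in the composition axiom *)

Definition comp_coef (n m : nat) : nat := (n * m)`! %/ (n`! * m`! ^ n).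

(** Splits one block of size m off (n + 1) m objects; the factor n + 1 is what
    makes (nm)! divisible by n! and not only by (m!)^n. *)
Lemma fact_mulSn (n m : nat) : (0 < m)%N ->
  ((n.+1 * m)`! = 'C((n.+1 * m).-1, m.-1) * (n.+1 * m`! * (n * m)`!))%N.
Proof.
case: m => // m _.
have le_m : (m.+1 <= n.+1 * m.+1)%N by rewrite leq_pmull.
have := mul_bin_diag (n.+1 * m.+1) m; rewrite mulnAC [(_ * m.+1)%N]mulnC -mulnA.
move/eqP; rewrite eqn_mul2l /= => /eqP diag.
rewrite -(bin_fact le_m) -diag [(n.+1 * m.+1 - m.+1)%N](_ : _ = (n * m.+1)%N).
  by rewrite !mulnA [('C(_, _) * n.+1)%N]mulnC.
by rewrite mulSn addKn.
Qed.

Lemma comp_coef_fact n m : (0 < m)%N ->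
  (comp_coef n m * (n`! * m`! ^ n) = (n * m)`!)%N.
Proof.
move=> m0; rewrite /comp_coef divnK //.
elim: n => [|n IHn]; first by rewrite mul0n fact0 expn0.
rewrite fact_mulSn // factS expnS dvdn_mull //.
by rewrite mulnACA dvdn_mul.
Qed.

Lemma comp_coefS n m : (0 < m)%N ->
  comp_coef n.+1 m = (comp_coef n m * 'C((n.+1 * m).-1, m.-1))%N.
Proof.
move=> m0; apply/eqP.
have pos : (0 < n.+1`! * m`! ^ n.+1)%N by rewrite muln_gt0 expn_gt0 !fact_gt0.
rewrite -(eqn_pmul2r pos) comp_coef_fact // fact_mulSn //.
rewrite -(comp_coef_fact n m0).
by rewrite factS expnS; apply/eqP; lia.
Qed.

(** The falling factorial (qp + p - 1) ... (qp + 1) has no factor divisible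
    by p. *)
Lemma bin_coprime (p q : nat) : prime p -> coprime p 'C((q.+1 * p).-1, p.-1).
Proof.
move=> pp; have p0 := prime_gt0 pp.
rewrite prime_coprime //; apply/negP => dvd.
have : (p %| (q.+1 * p).-1 ^_ p.-1)%N by rewrite -bin_ffact dvdn_mulr.
rewrite ffact_prod; apply/negP.
rewrite -prime_coprime // coprime_sym.
elim/big_ind: _ => [|x y|i _]; first exact: coprime1n.
  by rewrite coprimeMl => -> ->.
rewrite coprime_sym prime_coprime //.
have -> : ((q.+1 * p).-1 - i = q * p + (p.-1 - i))%N by have := ltn_ord i; lia.
rewrite dvdn_addr ?dvdn_mull // gtnNdvd //; have := ltn_ord i; lia.
Qed.

(** In characteristic p this lets the composition axiom be solved for
    gamma_(np) in terms of gamma_n and gamma_p. *)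
Lemma comp_coef_coprime (p n : nat) : prime p -> coprime p (comp_coef n p).
Proof.
move=> pp; elim: n => [|n IHn].
  by rewrite /comp_coef mul0n fact0 expn0 coprimen1.
by rewrite comp_coefS ?prime_gt0 // coprimeMr IHn bin_coprime.
Qed.

(** * Additivity of the composition axiom *)

(** Composition is left out so that these axioms can be the hypothesis of its
    own proof: they suffice to expand gamma_n (gamma_m (x + y)) when composition
    holds for x and for y. *)
Record is_weak_divided_power (A : comPzRingType) (I : ideal A)
    (gamma : nat -> A -> A) : Prop := IsWeakDividedPower {
  wdp0 : forall x, I x -> gamma 0%N x = 1;
  wdp1 : forall x, I x -> gamma 1%N x = x;
  wdp_ideal : forall n x, (1 <= n)%N -> I x -> I (gamma n x);
  wdpD : forall n x y, I x -> I y ->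
    gamma n (x + y) = \sum_(i < n.+1) gamma i x * gamma (n - i)%N y;
  wdpMl : forall n a x, I x -> gamma n (a * x) = a ^+ n * gamma n x;
  wdpM : forall n m x, I x ->
    gamma n x * gamma m x = 'C(n + m, n)%:R * gamma (n + m)%N x
}.

Definition composes (A : comPzRingType) (gamma : nat -> A -> A) (x : A) :=
  forall n m, (0 < m)%N ->
    gamma n (gamma m x) = (comp_coef n m)%:R * gamma (n * m)%N x.

Lemma wdp_zero (A : comPzRingType) (I : ideal A) (gamma : nat -> A -> A) n :
  is_weak_divided_power I gamma -> gamma n 0 = (n == 0%N)%:R.
Proof.
move=> dp; case: n => [|n]; first by rewrite (wdp0 dp) //; apply: ideal0.
by rewrite -(mul0r 0) (wdpMl dp) ?expr0n ?mul0r //; apply: ideal0.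
Qed.

(** Two elements that satisfy the composition axiom, together with all the
    data around them. Quantifying over this record makes it possible to speak
    of integer coefficients that are the same in all rings. *)
Record dp_pair := DpPair {
  dp_ring : comPzRingType;
  dp_id : ideal dp_ring;
  dp_map : nat -> dp_ring -> dp_ring;
  dp_weak : is_weak_divided_power dp_id dp_map;
  dp_fst : dp_ring;
  dp_snd : dp_ring;
  dp_fst_id : dp_id dp_fst;
  dp_snd_id : dp_id dp_snd;
  dp_fst_comp : composes dp_map dp_fst;
  dp_snd_comp : composes dp_map dp_snd
}.

Definition bipower (s : dp_pair) (N a : nat) : dp_ring s :=
  dp_map a (dp_fst s) * dp_map (N - a)%N (dp_snd s).

(** The family h has the form of an element of degree N in the free divided
    power ring on two generators, with non-negative coefficients. *)
Definition universal (N : nat) (h : forall s, dp_ring s) : Prop :=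
  exists c : nat -> nat,
    forall s, h s = \sum_(a < N.+1) (c a)%:R * bipower s N a.

Lemma universal_ext N (h h' : forall s, dp_ring s) :
  (forall s, h s = h' s) -> universal N h -> universal N h'.
Proof. by move=> hh' [c ch]; exists c => s; rewrite -hh'. Qed.

Lemma universal_bipower N a (b : nat) : (a <= N)%N ->
  universal N (fun s => b%:R * bipower s N a).
Proof.
move=> leaN; exists (fun i => if i == a then b else 0%N) => s.
have ltaN : (a < N.+1)%N by [].
rewrite (bigD1 (Ordinal ltaN)) //= eqxx big1 ?addr0 // => i.
by rewrite -val_eqE /= => /negPf ->; rewrite mul0r.
Qed.

Lemma universal0 N : universal N (fun s => 0).
Proof. by exists (fun=> 0%N) => s; rewrite big1 // => i _; rewrite mul0r. Qed.

Lemma universalD N h h' : universal N h -> universal N h' ->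
  universal N (fun s => h s + h' s).
Proof.
move=> [c ch] [c' ch']; exists (fun a => c a + c' a)%N => s.
by rewrite ch ch' -big_split; apply: eq_bigr => i _; rewrite natrD mulrDl.
Qed.

Lemma universal_sum N r (h : nat -> forall s, dp_ring s) :
  (forall i, (i < r)%N -> universal N (h i)) ->
  universal N (fun s => \sum_(i < r) h i s).
Proof.
elim: r => [|r IHr] uh.
  by apply: universal_ext (universal0 N) => s; rewrite big_ord0.
have := universalD (IHr (fun i lt_ir => uh i (ltnW lt_ir))) (uh r (ltnSn r)).
by apply: universal_ext => s; rewrite big_ord_recr.
Qed.

Lemma universalM N N' h h' : universal N h -> universal N' h' ->
  universal (N + N') (fun s => h s * h' s).
Proof.
move=> [c ch] [c' ch'].
suff : universal (N + N') (fun s => \sum_(a < N.+1) \sum_(b < N'.+1)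
    (c a * c' b * 'C(a + b, a) * 'C(N - a + (N' - b), N - a))%:R
      * bipower s (N + N') (a + b)).
  apply: universal_ext => s; rewrite ch ch' mulr_suml; apply: eq_bigr => a _.
  rewrite mulr_sumr; apply: eq_bigr => b _.
  have Ix := dp_fst_id s; have Iy := dp_snd_id s; have dp := dp_weak s.
  rewrite /bipower.
  transitivity ((c a)%:R * (c' b)%:R *
    (dp_map a (dp_fst s) * dp_map b (dp_fst s)) *
    (dp_map (N - a)%N (dp_snd s) * dp_map (N' - b)%N (dp_snd s))); last by ring.
  rewrite !(wdpM dp) // !natrM.
  have -> : (N + N' - (a + b) = N - a + (N' - b))%N.
    by have := ltn_ord a; have := ltn_ord b; lia.
  by ring.
apply: (universal_sum (h := fun a s => \sum_(b < N'.+1)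
    (c a * c' b * 'C(a + b, a) * 'C(N - a + (N' - b), N - a))%:R
      * bipower s (N + N') (a + b))) => a lta.
apply: (universal_sum (h := fun b s => 
    (c a * c' b * 'C(a + b, a) * 'C(N - a + (N' - b), N - a))%:R
      * bipower s (N + N') (a + b))) => b ltb.
by apply: universal_bipower; lia.
Qed.

Lemma universal_one : universal 0 (fun s => 1).
Proof.
apply: universal_ext (universal_bipower 1 (leqnn 0)) => s.
by rewrite /bipower !(wdp0 (dp_weak s)) ?mulr1 //; case: s.
Qed.

Lemma universalX N h u : universal N h -> universal (u * N) (fun s => h s ^+ u).
Proof.
move=> uh; elim: u => [|u IHu]; first exact: universal_one.
by rewrite mulSn; apply: universal_ext (universalM uh IHu) => s; rewrite exprS.
Qed.

Lemma universal_fst m : universal m (fun s => dp_map m (dp_fst s)).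
Proof.
apply: universal_ext (universal_bipower 1 (leqnn m)) => s.
by rewrite /bipower subnn (wdp0 (dp_weak s)) ?mulr1 ?mul1r //; apply: dp_snd_id.
Qed.

Lemma universal_snd m : universal m (fun s => dp_map m (dp_snd s)).
Proof.
apply: universal_ext (universal_bipower 1 (leq0n m)) => s.
by rewrite /bipower subn0 (wdp0 (dp_weak s)) ?mul1r //; apply: dp_fst_id.
Qed.

Lemma universal_natM N (b : nat) h : universal N h ->
  universal N (fun s => b%:R * h s).
Proof.
move=> [c ch]; exists (fun a => b * c a)%N => s.
by rewrite ch mulr_sumr; apply: eq_bigr => a _; rewrite natrM mulrA.
Qed.

(** gamma_u (gamma_i(x) gamma_j(y)) = gamma_i(x)^u gamma_u (gamma_j(y)), to
    which the composition axiom for y applies. When i or j vanishes one factor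
    is gamma_0 = 1, which need not lie in the ideal, hence the two boundary
    cases. *)
Lemma universal_comp_bipower u m i : (0 < m)%N -> (i <= m)%N ->
  universal (u * m) (fun s => dp_map u (bipower s m i)).
Proof.
move=> m0 leim; case: (posnP i) => [->|i0].
  apply: universal_ext (universal_natM (comp_coef u m) (universal_snd (u * m))).
  move=> s; rewrite /bipower (wdp0 (dp_weak s)); last exact: dp_fst_id.
  by rewrite mul1r subn0 dp_snd_comp.
case: (eqVneq i m) => [->|neim].
  apply: universal_ext (universal_natM (comp_coef u m) (universal_fst (u * m))).
  move=> s; rewrite /bipower subnn (wdp0 (dp_weak s)); last exact: dp_snd_id.
  by rewrite mulr1 dp_fst_comp.
have mi0 : (0 < m - i)%N by rewrite subn_gt0 ltn_neqAle neim.
have := universalM (universalX u (universal_fst i))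
  (universal_natM (comp_coef u (m - i)) (universal_snd (u * (m - i)))).
rewrite -mulnDr subnKC //; apply: universal_ext => s.
rewrite /bipower (wdpMl (dp_weak s)) ?dp_snd_comp //.
by apply: wdp_ideal (dp_weak s) _ _ _ _ => //; apply: dp_snd_id.
Qed.

Lemma bipower_ideal (s : dp_pair) m i : (0 < m)%N -> (i <= m)%N ->
  dp_id s (bipower s m i).
Proof.
move=> m0 leim; have dp := dp_weak s; rewrite /bipower.
case: (posnP i) => [->|i0].
  apply: ideal_mull; apply: (wdp_ideal dp); first by rewrite subn0.
  exact: dp_snd_id.
  by apply: ideal_mulr; apply: (wdp_ideal dp) => //; apply: dp_fst_id.
Qed.

Lemma universal_comp_sum n m r : (0 < m)%N -> (r <= m.+1)%N ->
  universal (n * m) (fun s => dp_map n (\sum_(i < r) bipower s m i)).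
Proof.
move=> m0; elim: r n => [|r IHr] n ler.
  case: n => [|n].
    apply: universal_ext universal_one => s.
    by rewrite big_ord0 (wdp_zero _ (dp_weak s)).
  apply: universal_ext (universal0 _) => s.
  by rewrite big_ord0 (wdp_zero _ (dp_weak s)).
suff : universal (n * m) (fun s => \sum_(u < n.+1)
    dp_map u (\sum_(i < r) bipower s m i) * dp_map (n - u)%N (bipower s m r)).
  apply: universal_ext => s.
  rewrite [in RHS]big_ord_recr /= (wdpD (dp_weak s)) //.
    apply: ideal_sum => i _; apply: bipower_ideal => //.
    by have := ltn_ord i; lia.
  exact: bipower_ideal.
apply: (universal_sum (h := fun u s =>
  dp_map u (\sum_(i < r) bipower s m i) * dp_map (n - u)%N (bipower s m r))).
move=> u ltu; have -> : (n * m = u * m + (n - u) * m)%N.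
  by rewrite -mulnDl subnKC.
by apply: universalM; [apply: IHr; lia|apply: universal_comp_bipower].
Qed.

Definition full_ideal (A : comPzRingType) : ideal A :=
  @Ideal A setT (And3 I (fun _ _ _ _ => I) (fun _ _ _ => I)).

(** The unit ideal of rational polynomials in X carries these divided powers;
    X and 1 play the role of two independent variables, since the exponent of X
    determines the other exponent once the total degree is fixed. *)
Definition fact_power (n : nat) (f : {poly rat}) : {poly rat} :=
  (n`!%:R^-1)%:P * f ^+ n.

Lemma rat_natr_neq0 n : (0 < n)%N -> n%:R != 0 :> rat.
Proof. by rewrite Num.Theory.pnatr_eq0 lt0n. Qed.

Lemma fact_power_weak :
  is_weak_divided_power (full_ideal {poly rat}) fact_power.
Proof.
have fact_neq0 n : n`!%:R != 0 :> rat by rewrite rat_natr_neq0 ?fact_gt0.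
have bin_rat n m :
    'C(n + m, n)%:R * (n + m)`!%:R^-1 = n`!%:R^-1 * m`!%:R^-1 :> rat.
  have /(congr1 (fun x => x%:R : rat)) := bin_fact (leq_addr m n).
  rewrite addKn !natrM => <-; rewrite invfM mulVKf ?invfM //.
  by rewrite rat_natr_neq0 // bin_gt0 leq_addr.
split=> //; rewrite /fact_power.
- by move=> x _; rewrite fact0 invr1 mul1r expr0.
- by move=> x _; rewrite invr1 mul1r expr1.
- move=> n x y _ _; rewrite addrC exprDn mulr_sumr; apply: eq_bigr => i _.
  have lein : (i <= n)%N by rewrite -ltnS.
  have := bin_rat i (n - i)%N; rewrite subnKC // => e.
  rewrite mulrACA -polyCM -e [x ^+ i * _]mulrC [_%:R / _]mulrC.
  rewrite polyCM polyC_natr.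
  by rewrite -mulrA mulr_natl.
- by move=> n a x _; rewrite exprMn mulrCA.
- move=> n m x _; rewrite mulrACA -polyCM -bin_rat polyCM polyC_natr exprD.
  by rewrite !mulrA.
Qed.

Lemma fact_power_composes f : composes fact_power f.
Proof.
move=> n m m0; rewrite /fact_power exprMn -exprM mulrA -polyC_exp -polyCM.
rewrite mulrA [(m * n)%N]mulnC -polyC_natr -polyCM; congr (_%:P * _).
rewrite -(comp_coef_fact n m0) !natrM natrX invfM mulrA mulfV ?mul1r.
  by rewrite invfM exprVn.
rewrite rat_natr_neq0 //; have := fact_gt0 (n * m).
by rewrite -(comp_coef_fact n m0) muln_gt0 => /andP[].
Qed.

(** Expanding gamma_n (gamma_m (x + y)) by the remaining axioms gives a
    combination of the products gamma_a(x) gamma_b(y), a + b = nm, with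
    coefficients that do not depend on the ring. Comparing coefficients of
    powers of X for x = X, y = 1 over the rationals shows that all of them
    equal (nm)! / (n! (m!)^n), and summing back gives gamma_(nm)(x + y). *)
Lemma composesD (A : comPzRingType) (I : ideal A) (gamma : nat -> A -> A) x y :
  is_weak_divided_power I gamma -> I x -> I y ->
  composes gamma x -> composes gamma y -> composes gamma (x + y).
Proof.
move=> dp Ix Iy Cx Cy n m m0.
have [c ch] := universal_comp_sum n m0 (leqnn _).
have cE a : (a < (n * m).+1)%N -> c a = comp_coef n m.
  move=> lta.
  pose s0 := @DpPair _ _ _ fact_power_weak 'X 1 Logic.I Logic.I
    (@fact_power_composes _) (@fact_power_composes _).
  have := ch s0; rewrite /bipower /=.
  rewrite -(wdpD fact_power_weak) // fact_power_composes //.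
  rewrite (wdpD fact_power_weak) // mulr_sumr.
  move/(congr1 (fun q : {poly rat} => q`_a)); rewrite !coef_sum.
  have coefE (b : nat) (i : 'I_(n * m).+1) :
      (b%:R * (fact_power i 'X * fact_power (n * m - i) 1))`_a =
      b%:R / i`!%:R / (n * m - i)`!%:R * (a == i)%:R.
    rewrite /fact_power expr1n mulr1 mulrAC mulrA -(rmorph_nat polyC).
    by rewrite -!polyCM coefCM coefXn mulrA.
  under eq_bigr do rewrite coefE.
  under [in RHS]eq_bigr do rewrite coefE.
  have pick (b : nat -> nat) : \sum_(i < (n * m).+1)
      (b i)%:R / i`!%:R / (n * m - i)`!%:R * (a == i)%:R =
      (b a)%:R / a`!%:R / (n * m - a)`!%:R :> rat.
    rewrite (bigD1 (Ordinal lta)) //= eqxx mulr1 big1 ?addr0 // => i.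
    by rewrite -val_eqE /= eq_sym => /negPf ->; rewrite mulr0.
  rewrite (pick (fun=> comp_coef n m)) (pick c).
  have fact_unit i : (i`!%:R^-1 : rat) \is a GRing.unit.
    by rewrite unitrV unitfE rat_natr_neq0 ?fact_gt0.
  move/(mulIr (fact_unit _))/(mulIr (fact_unit _))/eqP.
  by rewrite Num.Theory.eqr_nat => /eqP ->.
have := ch (@DpPair A I gamma dp x y Ix Iy Cx Cy); rewrite /bipower /=.
rewrite -(wdpD dp) // => ->; rewrite (wdpD dp) // mulr_sumr.
by apply: eq_bigr => i _; rewrite cE.
Qed.

(** * Axioms on generators *)

Section Generators.
Variables (A : comPzRingType) (S : set A) (gamma : nat -> A -> A).
Let I := ideal_gen S.
Hypothesis gamma0 : forall x, I x -> gamma 0%N x = 1.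
Hypothesis gammaD : forall n x y, I x -> I y ->
  gamma n (x + y) = \sum_(i < n.+1) gamma i x * gamma (n - i)%N y.
Hypothesis gammaMl : forall n a x, I x -> gamma n (a * x) = a ^+ n * gamma n x.
Hypothesis gamma1_gen : forall s, S s -> gamma 1%N s = s.
Hypothesis gamma_ideal_gen : forall n s, (0 < n)%N -> S s -> I (gamma n s).
Hypothesis gammaM_gen : forall n m s, S s ->
  gamma n s * gamma m s = 'C(n + m, n)%:R * gamma (n + m)%N s.
Hypothesis gamma_comp_gen : forall s, S s -> composes gamma s.

Lemma gamma_zero n : gamma n 0 = (n == 0%N)%:R.
Proof.
case: n => [|n]; first by rewrite gamma0 //; apply: ideal0.
by rewrite -(mul0r 0) gammaMl ?expr0n ?mul0r //; apply: ideal0.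
Qed.

Lemma gamma1_id x : I x -> gamma 1%N x = x.
Proof.
move: x; apply: ideal_gen_ind => //; first exact: gamma_zero.
  move=> x y Ix Iy x1 y1; rewrite gammaD // big_ord_recl big_ord1 /=.
  by rewrite subn0 subnn !gamma0 // x1 y1 mul1r mulr1 addrC.
by move=> a x Ix x1; rewrite gammaMl // x1 expr1.
Qed.

Lemma gamma_ideal n x : (0 < n)%N -> I x -> I (gamma n x).
Proof.
move=> n0 Ix; move: x Ix n n0.
apply: ideal_gen_ind => [n n0|x y Ix Iy Px Py n n0|a x Ix Px n n0|s Ss n n0].
- by rewrite gamma_zero -[n == _]negbK -lt0n n0; apply: ideal0.
- rewrite gammaD //; apply: ideal_sum => i _.
  case: (posnP i) => [->|i0].
    by rewrite subn0; apply: ideal_mull; apply: Py.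
  by apply: ideal_mulr; apply: Px.
- by rewrite gammaMl //; apply: ideal_mull; apply: Px.
- exact: gamma_ideal_gen.
Qed.

(** For a sum x + y the two sides agree by the Vandermonde convolution. *)
Lemma gamma_mul n m x : I x ->
  gamma n x * gamma m x = 'C(n + m, n)%:R * gamma (n + m)%N x.
Proof.
move=> Ix; move: x Ix n m.
apply: ideal_gen_ind => [n m|x y Ix Iy Px Py n m|a x Ix Px n m|s Ss n m].
- rewrite !gamma_zero addn_eq0; case: n => [|n]; last by rewrite mul0r mulr0.
  by rewrite add0n bin0.
- rewrite !gammaD // mulr_suml.
  (* The products gamma_i(x) gamma_(n-i)(y) gamma_j(x) gamma_(m-j)(y) are
     regrouped according to a = i + j. *)
  transitivity (\sum_(i < n.+1) \sum_(j < m.+1)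
      ('C(i + j, i) * 'C(n - i + (m - j), n - i))%:R *
      (gamma (i + j)%N x * gamma (n + m - (i + j))%N y)).
    apply: eq_bigr => i _; rewrite mulr_sumr; apply: eq_bigr => j _.
    rewrite mulrACA Px Py natrM.
    have -> : (n + m - (i + j) = n - i + (m - j))%N.
      by have := ltn_ord i; have := ltn_ord j; lia.
    by rewrite mulrACA.
  transitivity (\sum_(i < n.+1) \sum_(a < (n + m).+1 | (i <= a <= i + m)%N)
      ('C(a, i) * 'C(n + m - a, n - i))%:R *
      (gamma a x * gamma (n + m - a)%N y)).
    apply: eq_bigr => i _.
    have := ltn_ord i => lti.
    rewrite -(big_mkord xpredT
      (fun j => ('C(i + j, i) * 'C(n - i + (m - j), n - i))%:R *
        (gamma (i + j)%N x * gamma (n + m - (i + j))%N y))).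
    rewrite -(big_mkord (fun a => i <= a <= i + m)%N
      (fun a => ('C(a, i) * 'C(n + m - a, n - i))%:R *
        (gamma a x * gamma (n + m - a)%N y))).
    have le1 : (i <= (n + m).+1)%N by lia.
    have le2 : ((i + m).+1 <= (n + m).+1)%N by lia.
    rewrite [RHS](big_cat_nat (n := i)) //= [X in _ = X + _]big_nat_cond.
    rewrite [X in _ = X + _]big_pred0 ?add0r; last by move=> a; lia.
    rewrite [RHS](big_cat_nat (n := (i + m).+1)) //=; last by lia.
    rewrite [X in _ = _ + X]big_nat_cond.
    rewrite [X in _ = _ + X]big_pred0 ?addr0; last by move=> a; lia.
    rewrite -[X in _ = \sum_(X <= _ < _ | _) _]add0n big_addn -addnS addKn.
    rewrite [RHS]big_nat_cond [LHS]big_nat_cond.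
    apply: eq_big => [j|j]; first by lia.
    rewrite andbT [(j + i)%N]addnC => ltj; do 3 f_equal.
    by f_equal; lia.
  rewrite (exchange_big_dep xpredT) //= mulr_sumr.
  apply: eq_bigr => a _; rewrite -mulr_suml -natr_sum; congr (_%:R * _).
  have lta := ltn_ord a.
  rewrite -[in RHS](subnKC (_ : a <= n + m)%N) //.
  rewrite -binomial.Vandermonde big_mkcond.
  apply: eq_bigr => i _; have lti := ltn_ord i; case: ifPn => // nia.
  case: (ltnP a i) => [/bin_small ->//|leia].
  by rewrite ['C(n + m - a, _)]bin_small ?muln0 //; lia.
- by rewrite !gammaMl // mulrACA -exprD Px mulrCA.
- exact: gammaM_gen.
Qed.

Lemma weak_divided_power_gen : is_weak_divided_power I gamma.
Proof.
split=> //; [exact: gamma1_id|by move=> n x; apply: gamma_ideal|].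
by move=> n m x; apply: gamma_mul.
Qed.

Lemma gamma_composes x : I x -> composes gamma x.
Proof.
move: x; apply: ideal_gen_ind => //.
- move=> n m m0; rewrite (gamma_zero m) eqn0Ngt m0 !gamma_zero muln_eq0.
  rewrite [m == _]eqn0Ngt m0 orbF; case: n => [|n] /=; last by rewrite mulr0.
  by rewrite /comp_coef mul0n fact0 expn0 mulr1.
- by move=> x y Ix Iy Cx Cy; apply: composesD weak_divided_power_gen _ _ _ _.
- move=> a x Ix Cx n m m0.
  rewrite !gammaMl //; last exact: gamma_ideal.
  by rewrite Cx // -exprM mulrCA mulnC.
Qed.

(** Additivity and homogeneity propagate the other axioms from a generating
    set to the ideal; gamma_0 = 1 has to be known on the whole ideal, because an
    idempotent value gamma_0(0) is compatible with the rest when there are no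
    generators. *)
Lemma divided_power_gen : is_divided_power I gamma.
Proof.
split=> //; [exact: gamma1_id|by move=> n x; apply: gamma_ideal| |].
  by move=> n m x; apply: gamma_mul.
by move=> n m x m0 Ix; apply: gamma_composes.
Qed.

End Generators.

(** * Divided power ideals and quotients *)

Section CharacteristicP.
Variables (A : comPzRingType) (p : nat).
Hypotheses (p_prime : prime p) (pA0 : p%:R = 0 :> A).

(** Integers prime to p are invertible when p = 0. *)
Lemma ideal_cancel_coprime (N : ideal A) a z :
  coprime p a -> N (a%:R * z) -> N z.
Proof.
move=> co_pa; have a0 : (0 < a)%N.
  rewrite lt0n; apply: contraTneq co_pa => ->.
  by rewrite /coprime gcdn0 neq_ltn prime_gt1 ?orbT.
case: (egcdnP p a0) => u v uv _ Naz.
have -> : z = u%:R * (a%:R * z); last exact: ideal_mull.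
rewrite mulrA -natrM uv natrD natrM pA0 mulr0 add0r.
by rewrite gcdnC (eqP co_pa) mul1r.
Qed.

(** By induction on n, and additivity, only gamma_n(s) for a generator s
    matters. If p does not divide n then n gamma_n(s) = s gamma_(n-1)(s). If
    n = qp then gamma_n(s) is, up to an invertible integer, gamma_q of
    gamma_p(s), which lies in the ideal, and q < n. *)
Lemma divided_power_subideal (I : ideal A) (gamma : nat -> A -> A) (S : set A) :
  is_divided_power I gamma -> S `<=` I ->
  (forall s, S s -> ideal_gen S (gamma p s)) ->
  forall n z, (0 < n)%N -> ideal_gen S z -> ideal_gen S (gamma n z).
Proof.
move=> dp SI Sp n; elim/ltn_ind: n => n IHn z n0.
have NI : ideal_gen S `<=` I by apply: ideal_gen_sub.
move: z; apply: ideal_gen_ind => [|x y Nx Ny Px Py|a x Nx Px|s Ss].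
- rewrite -(mul0r 0) (dpMl dp) ?expr0n; last exact: ideal0.
  by rewrite eqn0Ngt n0 mul0r; apply: ideal0.
- rewrite (dpD dp); [|exact: NI|exact: NI]; apply: ideal_sum => i _.
  case: (posnP i) => [->|i0]; first by rewrite subn0; apply: ideal_mull.
  apply: ideal_mulr; have := ltn_ord i; rewrite ltnS leq_eqVlt.
  by case/orP=> [/eqP ->//|ltin]; apply: IHn.
- by rewrite (dpMl dp); [apply: ideal_mull|apply: NI].
have Is := SI _ Ss; case: (boolP (p %| n)%N) => [/dvdnP [q def_n]|p'n].
  have q0 : (0 < q)%N by move: n0; rewrite def_n muln_gt0 => /andP[].
  have ltqn : (q < n)%N by rewrite def_n ltn_Pmulr ?prime_gt1.
  apply: (ideal_cancel_coprime (comp_coef_coprime q p_prime)).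
  rewrite def_n -(dp_comp dp) ?prime_gt0 //.
  by apply: IHn => //; apply: Sp.
apply: (@ideal_cancel_coprime _ n); first by rewrite prime_coprime.
case: n n0 {IHn p'n} => // n _.
rewrite -[in n.+1%:R](bin1 n.+1) -add1n -(dpM dp) // (dp1 dp) //.
by apply: ideal_mulr; apply: mem_ideal_gen.
Qed.

End CharacteristicP.

Lemma eq_ideal_divided_power (A : comPzRingType) (I I' : ideal A)
    (gamma : nat -> A -> A) :
  (forall x, I x <-> I' x) ->
  is_divided_power I gamma -> is_divided_power I' gamma.
Proof.
move=> II' [d0 d1 di dD dl dM dc].
split=> [x|x|l x l0|l x y|l a x|l l' x|l l' x l'0].
- by move/II'; apply: d0.
- by move/II'; apply: d1.
- by move/II' => Ix; apply/II'/di.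
- by move=> /II' Ix /II' Iy; apply: dD.
- by move/II'; apply: dl.
- by move/II'; apply: dM.
- by move/II'; apply: dc.
Qed.

(** The value f (gamma_n z) only depends on f z: by additivity, adding an
    element of the kernel to z contributes terms that f kills. The section g
    is an arbitrary choice of z. *)
Lemma divided_power_image (A B : comPzRingType) (f : {rmorphism A -> B})
    (g : B -> A) (I : ideal A) (gamma : nat -> A -> A) :
  cancel g f -> is_divided_power I gamma ->
  (forall z, f z = 0 -> I z) ->
  (forall n z, (0 < n)%N -> f z = 0 -> f (gamma n z) = 0) ->
  is_divided_power (ideal_ext f I) (fun n y => f (gamma n (g y))).
Proof.
move=> gK dp kerI kerg.
have f_surj y : exists x, f x = y by exists (g y).
have gI y : ideal_ext f I y -> I (g y).
  move=> /(ideal_ext_surj I f_surj) [x Ix fxy].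
  rewrite -(subrK x (g y)); apply: idealD => //; apply: kerI.
  by rewrite rmorphB gK fxy subrr.
have gammaE n x x' : I x -> f x = f x' -> f (gamma n x') = f (gamma n x).
  move=> Ix fxx'; have Iz : f (x' - x) = 0 by rewrite rmorphB fxx' subrr.
  have Id := kerI _ Iz.
  rewrite -(subrK x x') (dpD dp) // big_ord_recl /= subn0.
  rewrite (dp0 dp) // mul1r rmorphD rmorph_sum big1 ?addr0 // => i _.
  by rewrite rmorphM kerg // mul0r.
split.
- by move=> y /gI Iy; rewrite (dp0 dp) ?rmorph1.
- by move=> y /gI Iy; rewrite (dp1 dp) ?gK.
- move=> n y n1 /gI Iy; apply/(ideal_ext_surj I f_surj).
  by exists (gamma n (g y)) => //; apply: (dp_ideal dp).
- move=> n x y /gI Ix /gI Iy.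
  rewrite (gammaE n (g x + g y)) ?rmorphD ?gK //; last exact: idealD.
  rewrite (dpD dp) // rmorph_sum; apply: eq_bigr => i _.
  by rewrite rmorphM.
- move=> n a x /gI Ix; rewrite (gammaE n (g a * g x)) ?rmorphM ?gK //.
    by rewrite (dpMl dp) // rmorphM rmorphXn gK.
  exact: ideal_mull.
- by move=> n m x /gI Ix; rewrite -rmorphM (dpM dp) // rmorphM rmorph_nat.
- move=> n m x m1 /gI Ix.
  rewrite (gammaE n (gamma m (g x))) ?gK //; last exact: (dp_ideal dp).
  by rewrite (dp_comp dp) // rmorphM rmorph_nat.
Qed.

(** * Order of vanishing at the origin *)

Section Order.
Variables (k : comUnitRingType) (n : nat).
Implicit Types f g : {mpoly k[n]}.

Definition order_ge (d : nat) : set {mpoly k[n]} :=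
  [set f : {mpoly k[n]} | forall m, (mdeg m < d)%N -> f@_m = 0].

Lemma order_geM d e f g :
  order_ge d f -> order_ge e g -> order_ge (d + e) (f * g).
Proof.
move=> fd ge m ltm; rewrite mcoeffM big1 // => -[m1 m2] /= /eqP def_m.
have [lt1|le1] := ltnP (mdeg m1) d; first by rewrite fd ?mul0r.
have := congr1 mdeg def_m; rewrite mdegD => deg_m.
by rewrite ge ?mulr0 //; lia.
Qed.

Lemma order_ge_is_ideal d : is_ideal (order_ge d).
Proof.
split=> [m _|f g fd gd m ltm|f g gd]; first by rewrite mcoeff0.
  by rewrite mcoeffD fd ?gd ?addr0.
by rewrite -[d]add0n; apply: order_geM.
Qed.

Definition order_ideal d : ideal {mpoly k[n]} := Ideal (order_ge_is_ideal d).

Lemma max_ideal0_order : max_ideal0 n k `<=` order_ideal 1.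
Proof.
apply: ideal_gen_sub => _ [j _ <-] m; rewrite ltnS leqn0 mdeg_eq0 => /eqP ->.
by rewrite mcoeffX mnm1_eq0.
Qed.

Lemma max_ideal0_sq_order :
  ideal_mul (max_ideal0 n k) (max_ideal0 n k) `<=` order_ideal 2.
Proof.
apply: ideal_gen_sub => _ [x mx [y my <-]].
by apply: (@order_geM 1 1); apply: max_ideal0_order.
Qed.

Lemma max_ideal0_coef0 f : max_ideal0 n k f -> f@_0 = 0.
Proof. by move=> /max_ideal0_order; apply; rewrite mdeg0. Qed.

Lemma max_ideal0_sq_sub :
  ideal_mul (max_ideal0 n k) (max_ideal0 n k) `<=` max_ideal0 n k.
Proof.
apply: ideal_gen_sub => _ [x _ [y my <-]].
exact: (ideal_mull (I := max_ideal0 n k)).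
Qed.

Lemma power_ideal_sub_max (i : 'I_n -> nat) :
  (forall j, (0 < i j)%N) -> power_ideal k i `<=` max_ideal0 n k.
Proof.
move=> i0; apply: ideal_gen_sub => _ [j _ <-].
rewrite -(prednK (i0 j)) exprS; apply: (ideal_mulr (I := max_ideal0 n k)).
by apply: mem_ideal_gen; exists j.
Qed.

Lemma power_ideal_mono (i i' : 'I_n -> nat) :
  (forall j, (i j <= i' j)%N) -> power_ideal k i' `<=` power_ideal k i.
Proof.
move=> le_ii'; apply: ideal_gen_sub => _ [j _ <-].
rewrite -(subnK (le_ii' j)) exprD; apply: (ideal_mull (I := power_ideal k i)).
by apply: mem_ideal_gen; exists j.
Qed.

Lemma monomial_factor (m : 'X_{1..n}) :
  m != 0%MM -> exists j m', m = (U_(j) + m')%MM.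
Proof.
move=> m0; have [j mj] : exists j, m j != 0%N.
  apply: contra_neqP m0 => /forallNP mj; apply/mnmP => j.
  by rewrite mnm0E; apply: contrapT => /eqP; apply: mj.
by exists j, (m - U_(j))%MM; rewrite addmC submK // lep1mP.
Qed.

Lemma max_ideal0_monomial (m : 'X_{1..n}) : m != 0%MM -> max_ideal0 n k 'X_[m].
Proof.
move=> /monomial_factor [j [m' ->]]; rewrite mpolyXD; apply: ideal_mulr.
by apply: mem_ideal_gen; exists j.
Qed.

End Order.

(** * Truncated exponentials *)

Section TruncatedExponential.
Variables (k : comUnitRingType) (p n : nat).
Hypothesis pchar_k : p \in [pchar k].
Notation P := {mpoly k[n]}.
Implicit Types (f g a y z : P) (m : 'X_{1..n}).

Let p_prime : prime p. Proof. exact: pcharf_prime pchar_k. Qed.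

Lemma fact_unit l : (l < p)%N -> (l`!%:R : k) \is a GRing.unit.
Proof.
move=> ltlp; have co_pl : coprime p l`!.
  rewrite prime_coprime //; elim: l ltlp => [|l IHl] ltlp.
    by rewrite fact0 dvdn1 neq_ltn prime_gt1 ?orbT.
  by rewrite factS Euclid_dvdM // negb_or IHl 1?ltnW // gtnNdvd.
case: (egcdnP p (fact_gt0 l)) => u v uv _; apply/unitrPr; exists u%:R.
rewrite -natrM mulnC uv natrD natrM (pcharf0 pchar_k) mulr0 add0r.
by rewrite gcdnC (eqP co_pl).
Qed.

(** The sum of the divided powers y^l / l! t^l of an element y whose divided
    powers of index at least p vanish, as a polynomial in t. *)
Definition trunc_exp (y : P) : {poly P} :=
  \poly_(l < p) ((l`!%:R : k)^-1 *: y ^+ l).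

Lemma coef_trunc_exp y l : (trunc_exp y)`_l =
  if (l < p)%N then (l`!%:R : k)^-1 *: y ^+ l else 0.
Proof. exact: coef_poly. Qed.

Lemma coef0_trunc_exp y : (trunc_exp y)`_0 = 1.
Proof. by rewrite coef_trunc_exp prime_gt0 // fact0 invr1 scale1r. Qed.

Lemma trunc_exp0 : trunc_exp 0 = 1.
Proof.
apply/polyP => l; rewrite coef_trunc_exp coef1 expr0n.
case: l => [|l]; first by rewrite prime_gt0 // fact0 invr1 scale1r.
by rewrite scaler0 if_same.
Qed.

(** Homogeneity, gamma_n (a x) = a^n gamma_n(x), at the level of generating
    functions. *)
Definition poly_scale (a : P) (u : {poly P}) : {poly P} := u \Po (a *: 'X).

Lemma coef_poly_scale a u i : (poly_scale a u)`_i = a ^+ i * u`_i.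
Proof.
rewrite /poly_scale comp_polyE coef_sum.
under eq_bigr do rewrite exprZn scalerA coefZ coefXn.
have [lt_iu|le_ui] := ltnP i (size u); last first.
  rewrite [u`_i]nth_default // mulr0 big1 // => j _.
  by rewrite gtn_eqF ?mulr0 // (leq_trans (ltn_ord j)).
rewrite (bigD1 (Ordinal lt_iu)) //= eqxx mulr1 big1 ?addr0 1?mulrC // => j.
by rewrite -val_eqE /= eq_sym => /negPf ->; rewrite mulr0.
Qed.

Lemma trunc_expMl a y : trunc_exp (a * y) = poly_scale a (trunc_exp y).
Proof.
apply/polyP => l; rewrite coef_poly_scale !coef_trunc_exp.
by case: ifP; rewrite ?mulr0 // exprMn scalerAr.
Qed.

(** The kernel of the reduction P[t] -> (P/K)[t]. The quotient of P[t] by it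
    stands for (P/K)[t], which avoids showing first that P/K is a nontrivial
    coefficient ring. *)
Definition poly_ideal_set (K : ideal P) : set {poly P} :=
  [set u : {poly P} | forall i, K u`_i].

Lemma poly_is_ideal (K : ideal P) : is_ideal (poly_ideal_set K).
Proof.
split=> [i|u v Ku Kv i|u v Kv i]; first by rewrite coef0; apply: ideal0.
  by rewrite coefD; apply: idealD.
by rewrite coefM; apply: ideal_sum => j _; apply: ideal_mull.
Qed.

Definition poly_ideal (K : ideal P) : ideal {poly P} := Ideal (poly_is_ideal K).

Lemma ideal_scale (K : ideal P) (c : k) y : K y -> K (c *: y).
Proof. by rewrite -mul_mpolyC; apply: ideal_mull. Qed.

(** Below degree p this is the binomial formula; from degree p on the product
    has only terms y^i z^j with i + j >= p. *)
Lemma trunc_expD (K : ideal P) y z :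
  (forall i j, (p <= i + j)%N -> K (y ^+ i * z ^+ j)) ->
  quot_proj (poly_ideal K) (trunc_exp (y + z)) =
  quot_proj (poly_ideal K) (trunc_exp y * trunc_exp z).
Proof.
move=> Kyz; apply/quot_proj_eq => l; rewrite coefB coef_trunc_exp coefM.
case: ltnP => [ltlp|lepl]; last first.
  rewrite sub0r; apply/idealN/ideal_sum => i _; rewrite !coef_trunc_exp.
  case: ifP => _; last by rewrite mul0r; apply: ideal0.
  case: ifP => _; last by rewrite mulr0; apply: ideal0.
  rewrite -scalerAl -scalerAr scalerA; apply/ideal_scale/Kyz.
  by rewrite subnKC // -ltnS.
rewrite [X in X - _](_ : _ =
    \sum_(i < l.+1) (trunc_exp y)`_i * (trunc_exp z)`_(l - i)).
  by rewrite subrr; apply: ideal0.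
rewrite addrC exprDn scaler_sumr; apply: eq_bigr => i _.
have leil : (i <= l)%N by rewrite -ltnS.
rewrite !coef_trunc_exp (leq_ltn_trans leil) //.
rewrite (leq_ltn_trans (leq_subr i l)) //.
rewrite -scalerAl -scalerAr scalerA [y ^+ i * _]mulrC -scaler_nat scalerA.
congr (_ *: _); rewrite -(bin_fact leil) !natrM.
have Ui := fact_unit (leq_ltn_trans leil ltlp).
have Uli := fact_unit (leq_ltn_trans (leq_subr i l) ltlp).
have Ub : ('C(l, i)%:R : k) \is a GRing.unit.
  have := fact_unit ltlp; rewrite -(bin_fact leil) natrM unitrM.
  by case/andP.
rewrite invrM ?unitrM ?Ui ?Uli // invrM // -mulrA.
by rewrite mulVr // mulr1 mulrC.
Qed.

(** * The generating function of the divided powers *)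

(** The generating function of the divided powers of f, obtained by imposing
    additivity on the terms of f. Leaving out the constant term makes gen_fun
    multiplicative modulo K on all polynomials, not only on those that vanish at
    the origin. *)
Definition gen_fun (f : P) : {poly P} :=
  \prod_(m <- msupp f | m != 0%MM) trunc_exp (f@_m *: 'X_[m]).

Lemma gen_fun_sub f (s : seq 'X_{1..n}) :
  uniq s -> {subset msupp f <= s} ->
  gen_fun f = \prod_(m <- s | m != 0%MM) trunc_exp (f@_m *: 'X_[m]).
Proof.
move=> Us fs; rewrite [RHS](bigID (mem (msupp f))) /=.
rewrite [X in _ = _ * X]big1 ?mulr1 => [|m /andP[_]]; last first.
  by rewrite mcoeff_msupp negbK => /eqP ->; rewrite scale0r trunc_exp0.
rewrite /gen_fun -[RHS]big_filter -[LHS]big_filter; apply: perm_big.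
apply: uniq_perm; rewrite ?filter_uniq ?msupp_uniq // => m.
rewrite !mem_filter; case: (m != 0%MM) => //=.
by case fm: (m \in msupp f) => //=; rewrite fs.
Qed.

Lemma gen_fun0 : gen_fun 0 = 1.
Proof. by rewrite /gen_fun msupp0 big_nil. Qed.

Lemma gen_fun_monomial (c : k) m : m != 0%MM ->
  gen_fun (c *: 'X_[m]) = trunc_exp (c *: 'X_[m]).
Proof.
move=> m0; rewrite (@gen_fun_sub _ [:: m]) //.
  by rewrite big_cons big_nil m0 mulr1 mcoeffZ mcoeffX eqxx mulr1.
by move=> m' /msuppZ_le; rewrite msuppX.
Qed.

Lemma coef0_gen_fun f : (gen_fun f)`_0 = 1.
Proof.
apply: (big_ind (fun u : {poly P} => u`_0 = 1)) => [|u v u0 v0|m _].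
- by rewrite coef1.
- by rewrite coef0M u0 v0 mulr1.
- exact: coef0_trunc_exp.
Qed.

Let K := power_ideal k (fun _ : 'I_n => p).
Notation proj := (quot_proj (poly_ideal K)).

Lemma monomial_powerp m : m != 0%MM -> K ('X_[m] ^+ p).
Proof.
move=> /monomial_factor [j [m' ->]].
rewrite mpolyXD exprMn; apply: ideal_mulr.
by apply: mem_ideal_gen; exists j.
Qed.

Lemma trunc_exp_addMl m a a' : m != 0%MM ->
  proj (trunc_exp ((a + a') * 'X_[m])) =
  proj (trunc_exp (a * 'X_[m])) * proj (trunc_exp (a' * 'X_[m])).
Proof.
move=> m0; rewrite mulrDl trunc_expD ?rmorphM // => i j lepij.
rewrite !exprMn mulrACA -exprD -(subnK lepij) exprD mulrA.
by apply: ideal_mull; apply: monomial_powerp.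
Qed.

Lemma gen_funD f g :
  proj (gen_fun (f + g)) = proj (gen_fun f) * proj (gen_fun g).
Proof.
pose s := undup (msupp f ++ msupp g ++ msupp (f + g)).
have Us : uniq s by apply: undup_uniq.
rewrite !(@gen_fun_sub _ s) //;
  try by move=> m mf; rewrite mem_undup !mem_cat mf ?orbT.
rewrite !rmorph_prod -big_split; apply: eq_bigr => m m0 /=.
by rewrite mcoeffD -!mul_mpolyC rmorphD /= trunc_exp_addMl.
Qed.

Lemma gen_fun_sum (T : Type) (r : seq T) (F : T -> P) :
  proj (gen_fun (\sum_(t <- r) F t)) = \prod_(t <- r) proj (gen_fun (F t)).
Proof.
apply: (big_morph (fun f => proj (gen_fun f)) gen_funD).
by rewrite gen_fun0 rmorph1.
Qed.

Lemma gen_fun_mulX a m : m != 0%MM ->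
  proj (gen_fun (a * 'X_[m])) = proj (trunc_exp (a * 'X_[m])).
Proof.
move=> m0; rewrite {1}(mpolyE a) mulr_suml gen_fun_sum.
rewrite [in RHS](mpolyE a) (big_morph (fun b => proj (trunc_exp (b * 'X_[m])))
  (fun b b' => trunc_exp_addMl b b' m0) (id1 := 1)); last first.
  by rewrite mul0r trunc_exp0 rmorph1.
apply: eq_bigr => m' _; rewrite -scalerAl -mpolyXD gen_fun_monomial //.
by rewrite mnmD_eq0 negb_and m0 orbT.
Qed.

(** Both sides are multiplicative in f, so f may be taken to be a monomial
    c X^m with m <> 0, for which the generating function of any multiple is
    again a truncated exponential. *)
Lemma gen_funMl a f : f@_0 = 0 ->
  proj (gen_fun (a * f)) = proj (poly_scale a (gen_fun f)).
Proof.
move=> f0; rewrite {1}(mpolyE f) mulr_sumr gen_fun_sum.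
have supp0 m : m \in msupp f -> m != 0%MM.
  by apply: contraTneq => ->; rewrite mcoeff_msupp f0 eqxx.
rewrite {2}/gen_fun /poly_scale !rmorph_prod [RHS]big_seq_cond.
rewrite [LHS]big_seq_cond; apply: eq_big => [m|m /andP[mf _]].
  by case mf: (m \in msupp f); rewrite //= supp0.
rewrite -mul_mpolyC mulrA gen_fun_mulX ?supp0 // -mulrA trunc_expMl.
by [].
Qed.

Lemma quot_proj_coef u v i :
  proj u = proj v -> quot_proj K u`_i = quot_proj K v`_i.
Proof. by move/quot_proj_eq => /(_ i); rewrite coefB => /quot_proj_eq. Qed.

(** On a generator x_j^p the truncated exponential is 1 modulo K, and
    multiplicativity spreads this to K. Hence gen_fun f modulo K only depends on
    the class of f. *)
Lemma gen_fun_power_ideal f : K f -> proj (gen_fun f) = 1.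
Proof.
have K0 : K `<=` max_ideal0 n k.
  by apply: power_ideal_sub_max => _; apply: prime_gt0.
move: f; apply: ideal_gen_ind => [|f g _ _ f1 g1|a f Kf f1|_ [j _ <-]].
- by rewrite gen_fun0 rmorph1.
- by rewrite gen_funD f1 g1 mulr1.
- rewrite gen_funMl; last by apply: max_ideal0_coef0; apply: K0.
  rewrite -(rmorph1 proj); apply/quot_proj_eq => i; rewrite coefB.
  rewrite coef_poly_scale coef1.
  have := quot_proj_coef i (etrans f1 (esym (rmorph1 proj))).
  move/quot_proj_eq; rewrite coef1; case: i => [|i].
    by rewrite expr0 mul1r.
  by rewrite !subr0; apply: ideal_mull.
- rewrite -(rmorph1 proj) mpolyXn -[X in gen_fun X]scale1r gen_fun_monomial.
    rewrite scale1r -mpolyXn; apply/quot_proj_eq => i.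
    rewrite coefB coef_trunc_exp coef1.
    case: i => [|i]; last first.
      rewrite subr0; case: ifP => _; last exact: ideal0.
      apply/ideal_scale; rewrite exprS; apply: ideal_mulr.
      by apply: mem_ideal_gen; exists j.
    rewrite prime_gt0 // fact0 invr1 scale1r expr0 subrr; exact: ideal0.
  by rewrite -mdeg_eq0 mdegMn mdeg1 mul1n -lt0n prime_gt0.
Qed.

(** * Divided powers on truncated polynomial rings *)

Definition trunc_dp (i : nat) (z : quot_ring K) : quot_ring K :=
  quot_proj K (gen_fun (repr z))`_i.

Lemma trunc_dp_proj i f :
  trunc_dp i (quot_proj K f) = quot_proj K (gen_fun f)`_i.
Proof.
apply: quot_proj_coef; set g := repr _.
have Kgf : K (g - f) by apply/quot_proj_eq; rewrite quot_projK.
by rewrite -(subrK f g) gen_funD gen_fun_power_ideal // mul1r.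
Qed.

Definition trunc_vars : set (quot_ring K) :=
  quot_proj K @` [set 'X_j | j in [set: 'I_n]].

Lemma trunc_vars_lift (z : quot_ring K) : ideal_gen trunc_vars z ->
  exists2 f, max_ideal0 n k f & quot_proj K f = z.
Proof.
move=> Iz; apply/(ideal_ext_surj _ (@quot_proj_surj _ _)).
apply: ideal_gen_sub Iz => _ [x Xx <-]; apply: mem_ideal_gen; exists x => //.
exact: mem_ideal_gen.
Qed.

Lemma trunc_dp_var i j : trunc_dp i (quot_proj K 'X_j) =
  if (i < p)%N then quot_proj K ((i`!%:R : k)^-1 *: 'X_j ^+ i) else 0.
Proof.
rewrite trunc_dp_proj -['X_j]scale1r gen_fun_monomial ?scale1r.
  by rewrite coef_trunc_exp; case: ifP; rewrite ?rmorph0.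
by rewrite mnm1_eq0.
Qed.

Lemma var_pow0 j l : (p <= l)%N -> K ('X_j ^+ l).
Proof.
move=> lepl; rewrite -(subnK lepl) exprD; apply: ideal_mull.
by apply: mem_ideal_gen; exists j.
Qed.

(** By the reduction to generators everything is checked on the variables,
    where gamma_l(x) = x^l / l! for l < p and 0 otherwise, and x^p = 0. *)
Lemma trunc_divided_power : is_divided_power (ideal_gen trunc_vars) trunc_dp.
Proof.
have dpMl : forall l (a x : quot_ring K), ideal_gen trunc_vars x ->
    trunc_dp l (a * x) = a ^+ l * trunc_dp l x.
  move=> l a _ /trunc_vars_lift [f mf <-]; rewrite -(quot_projK a).
  rewrite -rmorphM !trunc_dp_proj -rmorphXn -rmorphM -coef_poly_scale.
  by apply/quot_proj_coef/gen_funMl/max_ideal0_coef0.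
apply: divided_power_gen => //.
- move=> _ /trunc_vars_lift [f _ <-].
  by rewrite trunc_dp_proj coef0_gen_fun rmorph1.
- move=> l _ _ /trunc_vars_lift [f _ <-] /trunc_vars_lift [g _ <-].
  rewrite -rmorphD !trunc_dp_proj.
  rewrite (quot_proj_coef l (etrans (gen_funD f g) (esym (rmorphM _ _ _)))).
  rewrite coefM rmorph_sum; apply: eq_bigr => i _.
  by rewrite rmorphM !trunc_dp_proj.
- move=> _ [_ [j _ <-] <-]; rewrite trunc_dp_var prime_gt1 //.
  by rewrite invr1 scale1r expr1.
- move=> l _ l0 [_ [j _ <-] <-]; rewrite trunc_dp_var.
  case: ifP => _; last exact: ideal0.
  rewrite -(prednK l0) exprS scalerAr rmorphM; apply: ideal_mulr.
  by apply: mem_ideal_gen; exists 'X_j => //; exists j.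
- move=> l l' _ [_ [j _ <-] <-]; rewrite !trunc_dp_var.
  case: ltnP => [ltl|lel]; last first.
    by rewrite mul0r ltnNge (leq_trans lel (leq_addr _ _)) mulr0.
  case: ltnP => [ltl'|lel']; last first.
    by rewrite mulr0 ltnNge (leq_trans lel' (leq_addl _ _)) mulr0.
  rewrite -rmorphM -scalerAl -scalerAr scalerA -exprD.
  case: ltnP => [lt|le]; last first.
    by rewrite mulr0; apply/quot_proj_eq0; apply: ideal_scale; apply: var_pow0.
  rewrite -(rmorph_nat (quot_proj K)) -rmorphM mulr_natl -scaler_nat scalerA.
  congr (quot_proj K (_ *: _)).
  have := fact_unit lt; rewrite -(bin_fact (leq_addr l' l)) addKn !natrM => U.
  have [Ub /[!unitrM] /andP[Ul Ul']] : ('C(l + l', l)%:R : k) \is a GRing.unit /\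
     (l`!%:R * l'`!%:R : k) \is a GRing.unit by move: U; rewrite unitrM => /andP.
  rewrite [in RHS]invrM ?unitrM ?Ul ?Ul' // [RHS]mulrCA mulrV // mulr1.
  by rewrite invrM // mulrC.
- move=> _ [_ [j _ <-] <-] l m m0; rewrite !trunc_dp_var.
  have varI : ideal_gen trunc_vars (quot_proj K 'X_j).
    by apply: mem_ideal_gen; exists 'X_j => //; exists j.
  have dp_zero : trunc_dp l 0 = (l == 0%N)%:R.
    rewrite -(rmorph0 (quot_proj K)) trunc_dp_proj gen_fun0 coef1.
    by case: l => [|l] //=; rewrite ?rmorph1 ?rmorph0.
  case: (ltnP m p) => [ltm|lem]; last first.
    rewrite dp_zero; case: (posnP l) => [->|l0].
      rewrite mul0n prime_gt0 // /comp_coef mul0n fact0 expn0 mul1r.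
      by rewrite invr1 scale1r expr0 rmorph1.
    by rewrite ltnNge (leq_trans lem) ?leq_pmull // mulr0.
  rewrite -[m in 'X_j ^+ m](prednK m0) exprSr scalerAl rmorphM dpMl //.
  rewrite trunc_dp_var.
  case: (ltnP l p) => [ltl|lel]; last first.
    by rewrite mulr0 ltnNge (leq_trans lel) ?leq_pmulr // mulr0.
  rewrite -rmorphXn -rmorphM exprZn -scalerAl -scalerAr scalerA -exprM -exprD.
  have -> : (m.-1 * l + l = l * m)%N by rewrite -mulSnr prednK // mulnC.
  case: (ltnP (l * m)%N p) => [ltlm|lelm]; last first.
    by rewrite mulr0; apply/quot_proj_eq0; apply: ideal_scale; apply: var_pow0.
  rewrite -(rmorph_nat (quot_proj K)) -rmorphM mulr_natl -scaler_nat scalerA.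
  congr (quot_proj K (_ *: _)).
  have Um := unitrX l (fact_unit ltm); have Ul := fact_unit ltl.
  have := fact_unit ltlm; rewrite -(comp_coef_fact l m0) !natrM natrX => U.
  have Uc : ((comp_coef l m)%:R : k) \is a GRing.unit.
    by move: U; rewrite unitrM => /andP[].
  rewrite invrM ?unitrM ?Ul ?Um // mulrCA mulrV // mulr1 invrM //.
  by rewrite exprVn.
Qed.

End TruncatedExponential.

(** * The polynomial w_p *)

Section Main.
Variables (k : comUnitRingType) (p n : nat).
Hypothesis pchar_k : p \in [pchar k].
Notation P := {mpoly k[n]}.
Implicit Types (f g : P) (m : 'X_{1..n}).

Let p_prime : prime p. Proof. exact: pcharf_prime pchar_k. Qed.

Lemma supp_neq0 f m : f@_0 = 0 -> m \in msupp f -> m != 0%MM.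
Proof. by move=> f0; apply: contraTneq => ->; rewrite mcoeff_msupp f0 eqxx. Qed.

Lemma gen_fun_supp f : f@_0 = 0 ->
  gen_fun p f = \prod_(m <- msupp f) trunc_exp p (f@_m *: 'X_[m]).
Proof.
move=> f0; rewrite /gen_fun [RHS]big_seq_cond [LHS]big_seq_cond.
apply: eq_bigl => m; case mf: (m \in msupp f) => //=.
by rewrite (supp_neq0 f0).
Qed.

(** Expanding the product chooses one exponent l_j < p for every factor. *)
Lemma coef_prod_trunc_exp (s : nat) (t : 'I_s -> P) (d : nat) :
  (\prod_j trunc_exp p (t j))`_d =
  \sum_(l : {ffun 'I_s -> 'I_p} | (\sum_j l j == d)%N)
    (\prod_j ((l j)`!%:R : k))^-1 *: \prod_j t j ^+ l j.
Proof.
have expE j : trunc_exp p (t j) =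
    \sum_(l < p) ((l`!%:R : k)^-1 *: t j ^+ l) *: 'X^l.
  by rewrite /trunc_exp poly_def.
under eq_bigr do rewrite expE.
rewrite bigA_distr_bigA coef_sum [RHS]big_mkcond; apply: eq_bigr => l _.
rewrite scaler_prod prodrXr coefZ coefXn eq_sym.
case: ifP => _; last by rewrite mulr0.
rewrite mulr1 scaler_prod; congr (_ *: _); rewrite prodrV // => j _.
exact: (fact_unit pchar_k).
Qed.

Lemma w_pE f : f@_0 = 0 -> w_p p f = (gen_fun p f)`_p.
Proof.
by move=> f0; rewrite gen_fun_supp // big_tnth coef_prod_trunc_exp.
Qed.

(** * Vanishing of w_p in the quotient *)

Section Necessity.
Variables (A : comPzRingType) (I : ideal A) (gamma : nat -> A -> A).
Hypothesis dp : is_divided_power I gamma.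

Lemma fact_gamma l x : I x -> l`!%:R * gamma l x = x ^+ l.
Proof.
move=> Ix; elim: l => [|l IHl]; first by rewrite fact0 mul1r (dp0 dp).
rewrite exprS -IHl -[X in _ = X * _](dp1 dp) // mulrCA (dpM dp) // add1n bin1.
by rewrite mulrA -natrM mulnC factS.
Qed.

(** In any divided power structure gamma_l(x) = x^l / l! for l < p, so the
    vanishing of gamma_p(x) is all that a truncated exponential requires up to
    degree p. *)
Lemma gamma_trunc_exp (h : {rmorphism P -> A}) f l :
  I (h f) -> gamma p (h f) = 0 -> (l <= p)%N ->
  gamma l (h f) = h (trunc_exp p f)`_l.
Proof.
move=> If gp0; rewrite leq_eqVlt coef_trunc_exp => /orP[/eqP ->|ltlp].
  by rewrite ltnn rmorph0.
rewrite ltlp -mul_mpolyC rmorphM rmorphXn -fact_gamma // mulrA.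
rewrite -(rmorph_nat h) -rmorphM -(mpolyC_nat n) -mpolyCM.
rewrite mulVr ?rmorph1 ?mul1r //.
exact: (fact_unit pchar_k).
Qed.

Lemma gamma_sum_trunc_exp (h : {rmorphism P -> A}) (T : Type) (r : seq T)
    (t : T -> P) l :
  (forall x, I (h (t x))) -> (forall x, gamma p (h (t x)) = 0) -> (l <= p)%N ->
  gamma l (h (\sum_(x <- r) t x)) = h (\prod_(x <- r) trunc_exp p (t x))`_l.
Proof.
move=> It tp0; elim: r l => [|x r IHr] l lelp.
  rewrite !big_nil rmorph0 coef1 rmorph_nat; case: l lelp => [|l] _.
    by rewrite (dp0 dp) //; apply: ideal0.
  by rewrite -(mul0r 0) (dpMl dp) ?expr0n ?mul0r //; apply: ideal0.
rewrite !big_cons rmorphD (dpD dp) //; last first.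
  by rewrite rmorph_sum; apply: ideal_sum.
rewrite coefM [RHS]rmorph_sum; apply: eq_bigr => i _.
have := ltn_ord i; rewrite ltnS => leil.
rewrite rmorphM -gamma_trunc_exp ?IHr //.
  exact: leq_trans (leq_subr _ _) lelp.
exact: leq_trans leil lelp.
Qed.

End Necessity.

(** Every term of f0 has the form x_j y with y in the maximal ideal, so its
    gamma_p is x_j^p gamma_p(y) = 0. Additivity then identifies gamma_p(f0) with
    the class of w_p(f0), while f0 = 0 in the quotient. *)
Lemma divided_power_w_p (J : ideal P) f0 :
  power_ideal k (fun _ : 'I_n => p) `<=` J ->
  admits_divided_powers (ideal_ext (quot_proj J) (max_ideal0 n k)) ->
  ideal_mul (max_ideal0 n k) (max_ideal0 n k) f0 -> J f0 -> J (w_p p f0).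
Proof.
move=> KJ [gamma dp] f0sq Jf0.
have mA f : max_ideal0 n k f ->
    ideal_ext (quot_proj J) (max_ideal0 n k) (quot_proj J f).
  by move=> mf; apply: mem_ideal_gen; exists f.
have f00 : f0@_0 = 0 by apply: max_ideal0_coef0; apply: max_ideal0_sq_sub.
have deg2 m : m \in msupp f0 -> (2 <= mdeg m)%N.
  rewrite mcoeff_msupp leqNgt; apply: contra_neqN => ltm.
  exact: max_ideal0_sq_order.
(* Outside the support the terms are zero, so the two facts below can be
   stated for all monomials. *)
pose t m : P := f0@_m *: 'X_[m].
have t_mem m : ideal_ext (quot_proj J) (max_ideal0 n k) (quot_proj J (t m)).
  apply: mA; rewrite /t; case: (boolP (m \in msupp f0)) => [mf|].
    by apply: ideal_scale; apply: max_ideal0_monomial; apply: supp_neq0 mf.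
  by rewrite mcoeff_msupp negbK => /eqP ->; rewrite scale0r; apply: ideal0.
have t_p m : gamma p (quot_proj J (t m)) = 0.
  have p0 : (0 : quot_ring J) ^+ p = 0 by rewrite expr0n eqn0Ngt prime_gt0.
  rewrite /t; case: (boolP (m \in msupp f0)) => [mf|]; last first.
    rewrite mcoeff_msupp negbK => /eqP ->; rewrite scale0r rmorph0.
    by rewrite -(mul0r 0) (dpMl dp) ?p0 ?mul0r //; apply: ideal0.
  have [j [m' def_m]] := monomial_factor (supp_neq0 f00 mf).
  have m'0 : m' != 0%MM.
    by rewrite -mdeg_eq0 -lt0n; have := deg2 m mf; rewrite def_m mdegD mdeg1.
  rewrite def_m mpolyXD scalerAl rmorphM (dpMl dp); last first.
    by apply: mA; apply: max_ideal0_monomial.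
  rewrite -rmorphXn exprZn /=.
  have /quot_proj_eq0 -> : J ((f0@_(U_(j) + m') ^+ p) *: 'X_j ^+ p).
    apply: ideal_scale; apply: KJ.
    by apply: (@mem_ideal_gen _ _ ('X_j ^+ p)); exists j.
  by rewrite mul0r.
apply/quot_proj_eq0; rewrite w_pE // gen_fun_supp //.
rewrite -(gamma_sum_trunc_exp dp (msupp f0) t_mem t_p (leqnn p)).
rewrite -mpolyE /= (proj2 (quot_proj_eq0 J f0) Jf0) -(mul0r 0) (dpMl dp).
  by rewrite expr0n eqn0Ngt prime_gt0 // !mul0r.
exact: ideal0.
Qed.

(** * Construction of the divided powers *)

Section Sufficiency.
Variable J : ideal P.
Let K := power_ideal k (fun _ : 'I_n => p).
Hypothesis KJ : K `<=` J.

Definition trunc_quot (z : quot_ring K) : quot_ring J := quot_proj J (repr z).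

Lemma trunc_quot_proj f : trunc_quot (quot_proj K f) = quot_proj J f.
Proof.
apply/quot_proj_eq/KJ; apply: (proj1 (quot_proj_eq K _ _)).
exact: quot_projK.
Qed.

Lemma trunc_quotB : {morph trunc_quot : x y / x - y}.
Proof.
move=> x y; rewrite -(quot_projK x) -(quot_projK y).
by rewrite -rmorphB !trunc_quot_proj rmorphB.
Qed.

Lemma trunc_quotM : {morph trunc_quot : x y / x * y}.
Proof.
move=> x y; rewrite -(quot_projK x) -(quot_projK y).
by rewrite -rmorphM !trunc_quot_proj rmorphM.
Qed.

Lemma trunc_quot1 : trunc_quot 1 = 1.
Proof. by rewrite -(rmorph1 (quot_proj K)) trunc_quot_proj rmorph1. Qed.

HB.instance Definition _ :=
  GRing.isZmodMorphism.Build (quot_ring K) (quot_ring J) trunc_quot trunc_quotB.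
HB.instance Definition _ :=
  GRing.isMonoidMorphism.Build (quot_ring K) (quot_ring J) trunc_quot
    (trunc_quot1, trunc_quotM).

(** The image of J in P/K is stable under the divided powers of P/K as soon as
    gamma_p sends its generators into it, and then they descend to P/J. *)
Lemma w_p_divided_power (S : set P) :
  S `<=` max_ideal0 n k ->
  (forall f, J f -> ideal_gen (quot_proj K @` S) (quot_proj K f)) ->
  S `<=` J ->
  (forall s, S s -> J (gen_fun p s)`_p) ->
  admits_divided_powers (ideal_ext (quot_proj J) (max_ideal0 n k)).
Proof.
move=> Sm JS SJ Sp.
have dpB := @trunc_divided_power k p n pchar_k.
have m_vars f : max_ideal0 n k f ->
    ideal_gen (@trunc_vars k p n) (quot_proj K f) by apply: ideal_ext_gen.
have kerS z : trunc_quot z = 0 -> ideal_gen (quot_proj K @` S) z.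
  by rewrite -(quot_projK z) trunc_quot_proj => /quot_proj_eq0 /JS.
have Sker z : ideal_gen (quot_proj K @` S) z -> trunc_quot z = 0.
  move: z; apply: ideal_gen_ind => [|x y _ _ x0 y0|a x _ x0|_ [s Ss <-]].
  - by rewrite rmorph0.
  - by rewrite rmorphD /= x0 y0 addr0.
  - by rewrite rmorphM /= x0 mulr0.
  - by rewrite trunc_quot_proj; apply/quot_proj_eq0/SJ.
have S_vars : quot_proj K @` S `<=` ideal_gen (@trunc_vars k p n).
  by move=> _ [s Ss <-]; apply: m_vars; apply: Sm.
have p0 : p%:R = 0 :> quot_ring K.
  rewrite -(rmorph_nat (quot_proj K)) -(mpolyC_nat n) (pcharf0 pchar_k).
  by rewrite !rmorph0.
have gK : cancel (fun y : quot_ring J => quot_proj K (repr y)) trunc_quot.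
  by move=> y; rewrite trunc_quot_proj quot_projK.
have S_gamma s : (quot_proj K @` S) s ->
    ideal_gen (quot_proj K @` S) (trunc_dp p s).
  by move=> [f Sf <-]; rewrite trunc_dp_proj //; apply: JS; apply: Sp.
have sub := divided_power_subideal p_prime p0 dpB S_vars S_gamma.
have dpJ := divided_power_image gK dpB
  (fun z z0 => ideal_gen_sub S_vars (kerS z z0))
  (fun i z i0 z0 => Sker _ (sub i z i0 (kerS z z0))).
eexists; apply: eq_ideal_divided_power dpJ => y; split.
- apply: ideal_gen_sub => _ [z zv <-].
  have [f mf <-] := trunc_vars_lift zv.
  by apply: mem_ideal_gen; exists f => //; rewrite /= trunc_quot_proj.
- apply: ideal_gen_sub => _ [f mf <-]; rewrite -trunc_quot_proj.
  by apply: mem_ideal_gen; exists (quot_proj K f) => //; apply: m_vars.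
Qed.

End Sufficiency.
End Main.

Theorem proposition3p1 (k : comUnitRingType) (p : nat) (hp : p \in [pchar k])
    (n : nat) (I : ideal {mpoly k[n]})
    (hI : I `<=` ideal_mul (max_ideal0 n k) (max_ideal0 n k))
    (i : 'I_n -> nat) (hi : forall j, (0 < i j <= p)%N)
    (T0 : set {mpoly k[n]}) (hT0I : T0 `<=` I)
    (hT0 : ideal_gen T0 = I :> set {mpoly k[n]}) :
  let J := ideal_add (power_ideal k i) I in
  [<-> admits_divided_powers (ideal_ext (quot_proj J) (max_ideal0 n k));
       forall f0, I f0 -> J (w_p p f0);
       forall f0, T0 f0 -> J (w_p p f0)].
Proof.
move=> J.
have p_prime := pcharf_prime hp.
have powJ : power_ideal k i `<=` J.
  by move=> f pf; exists f => //; exists 0; [apply: (ideal0 I)|rewrite addr0].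
have IJ : I `<=` J.
  move=> f If; exists 0; first exact: (ideal0 (power_ideal k i)).
  by exists f => //; rewrite add0r.
have KJ : power_ideal k (fun=> p) `<=` J.
  move=> f Kf; apply: powJ; move: f Kf; apply: power_ideal_mono => j.
  by case/andP: (hi j).
have T0m : T0 `<=` max_ideal0 n k.
  by move=> f /hT0I /hI; apply: max_ideal0_sq_sub.
tfae.
- move=> dpA f0 If0; apply: divided_power_w_p dpA _ _ => //; first exact: hI.
  exact: IJ.
- by move=> wI f0 /hT0I; apply: wI.
move=> wT.
pose S := [set 'X_j ^+ i j | j in [set: 'I_n]] `|` T0.
apply: (@w_p_divided_power k p n hp J KJ S).
- move=> f [[j _ <-]|/T0m //].
  apply: (@power_ideal_sub_max k n i) => [j'|]; first by case/andP: (hi j').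
  by apply: mem_ideal_gen; exists j.
- move=> _ [f pf [g Ig <-]]; rewrite rmorphD.
  have gen_mono (T T' : set {mpoly k[n]}) h :
      T `<=` T' -> ideal_gen T h -> ideal_gen T' h.
    move=> TT'; apply: ideal_gen_sub => x Tx.
    exact: (mem_ideal_gen (TT' _ Tx)).
  apply: idealD; apply: ideal_ext_gen.
    by apply: gen_mono pf; apply: subsetUl.
  by move: Ig; rewrite -hT0; apply: gen_mono; apply: subsetUr.
- move=> f [[j _ <-]|/hT0I]; last exact: IJ.
  by apply: powJ; apply: mem_ideal_gen; exists j.
move=> f [[j _ <-]|Tf]; last first.
  by rewrite -w_pE //; [apply: wT|apply: max_ideal0_coef0; apply: T0m].
(* gamma_p (x^i) = x^(p (i - 1)) gamma_p(x), and gamma_p(x) = 0. *)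
case/andP: (hi j) => ij0 _.
have Xj0 : ('X_j : {mpoly k[n]})@_0 = 0.
  by apply: max_ideal0_coef0; apply: mem_ideal_gen; exists j.
have /(quot_proj_coef p) /quot_proj_eq := gen_funMl hp ('X_j ^+ (i j).-1) Xj0.
rewrite -exprSr prednK // coef_poly_scale -['X_j]scale1r (gen_fun_monomial hp).
  by rewrite coef_trunc_exp ltnn mulr0 subr0; apply: KJ.
by rewrite mnm1_eq0.
Qed.
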